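(* Let $G$ be a finite group. For $g\in G$ put $N(g)=|\{(x,y)\in G\times G : x^{-1}y^{-1}xy=g\}|$, and let $P^G(g)=N(g)/|G|^2$ and $U^G(g)=1/|G|$. Then $$\|P^G-U^G\|_1=\sum_{g\in G}|P^G(g)-U^G(g)|\le (\zeta^G(2)-1)^{1/2}.$$
   Context: For a finite group $G$, $\mathrm{Irr}(G)$ denotes the set of complex irreducible characters of $G$, and the Witten zeta function of $G$ is $\zeta^G(s)=\sum_{\chi\in\mathrm{Irr}(G)}\chi(1)^{-s}$ for real $s$. *)

(* Defs.v *)
From HB Require Import structures.
From mathcomp Require Import all_boot all_order all_algebra all_fingroup.
From mathcomp Require Import all_solvable all_field all_character.
From mathcomp Require Import reals exp.

Set Implicit Arguments.
Unset Strict Implicit.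
Unset Printing Implicit Defensive.

Import Order.TTheory GRing.Theory Num.Theory.
Local Open Scope ring_scope.

(* 'chi_i 1 is an algC whose value is a natural number, so Num.truncn loses
   nothing; it lets the degree be raised to a real power in R. *)
Definition irr_degree (gT : finGroupType) (G : {group gT}) (i : Iirr G) : nat :=
  Num.truncn ('chi[G]_i 1%g).

Definition witten_zeta (R : realType) (gT : finGroupType) (G : {group gT})
    (s : R) : R :=
  \sum_(i : Iirr G) (irr_degree i)%:R `^ (- s).

Definition commutator_fiber (gT : finGroupType) (G : {group gT}) (g : gT) :
    {set gT * gT} :=
  [set p in setX G G | (p.1^-1 * p.2^-1 * p.1 * p.2 == g)%g].

Definition commutator_distr (R : realType) (gT : finGroupType)
    (G : {group gT}) (g : gT) : R :=
  #|commutator_fiber G g|%:R / #|G|%:R ^+ 2.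

Definition uniform_distr (R : realType) (gT : finGroupType)
    (G : {group gT}) (g : gT) : R :=
  #|G|%:R^-1.

Definition l1_norm (R : realType) (gT : finGroupType) (G : {group gT})
    (f : gT -> R) : R :=
  \sum_(g in G) `|f g|.

(* Main.v *)
(* In the basis Irr(G), the class function N has coefficients |G| / chi(1): this
   follows from sum_y chi(a b^y) = |G| chi(a) chi(b) / chi(1), since
   [x, y] = x^-1 x^y. The trivial character contributes the constant |G|, so
   orthonormality gives sum_g (N(g) - |G|)^2 = |G|^3 (zeta(2) - 1), and the
   Cauchy-Schwarz inequality bounds the L^1 norm. *)

Require Import Defs.
From HB Require Import structures.
From mathcomp Require Import all_boot all_order all_algebra all_fingroup.
From mathcomp Require Import all_solvable all_field all_character.
From mathcomp Require Import reals exp.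
From mathcomp Require Import ring.

Set Implicit Arguments.
Unset Strict Implicit.
Unset Printing Implicit Defensive.

Import Order.TTheory GRing.Theory Num.Theory.
Local Open Scope ring_scope.

(** Cauchy-Schwarz against the constant 1, obtained by expanding the nonnegative sum of squared
    deviations of [f] from its mean over [A]. The empty case is split off because the mean divides
    by the cardinality. *)
Lemma ler_sqr_sum_card (R : realFieldType) (T : finType) (A : {pred T})
    (f : T -> R) :
  (\sum_(x in A) f x) ^+ 2 <= #|A|%:R * \sum_(x in A) f x ^+ 2.
Proof.
have [A0|A_gt0] := posnP #|A|.
  by rewrite A0 mul0r big_pred0 ?expr0n //; apply/card0_eq.
set n : R := _%:R; set s := \sum_(x in A) f x; set q := \sum_(x in A) _.
have n_gt0 : 0 < n by rewrite ltr0n.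
have : 0 <= \sum_(x in A) (f x - s / n) ^+ 2.
  by apply: sumr_ge0 => x _; exact: sqr_ge0.
have -> : \sum_(x in A) (f x - s / n) ^+ 2
    = q - s / n *+ 2 * s + (s / n) ^+ 2 * n.
  rewrite /q [in X in _ + X]mulr_natr -sumr_const mulr_sumr -sumrB -big_split /=.
  by apply: eq_bigr => x _; rewrite sqrrB -mulrnAr mulrC.
have -> : q - s / n *+ 2 * s + (s / n) ^+ 2 * n = (n * q - s ^+ 2) / n.
  by field; rewrite gt_eqF.
by rewrite pmulr_lge0 ?invr_gt0 // subr_ge0.
Qed.

Section CommutatorCount.

Variables (gT : finGroupType) (G : {group gT}).

(* As a function of [b] the left-hand side is a class function, so it suffices to
   compute its inner products with the irreducible characters. *)
Lemma irr_sum_mulJ (i : Iirr G) a b : a \in G -> b \in G ->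
  \sum_(y in G) 'chi_i (a * b ^ y)%g
    = #|G|%:R * ('chi_i a * 'chi_i b / 'chi_i 1%g).
Proof.
move=> Ga Gb.
(* The value 0 outside [G] meets the support condition of ['CF(G)]. *)
pose f b : algC := if b \in G then \sum_(y in G) 'chi_i (a * b ^ y)%g else 0.
have fP : is_class_fun <<G>>%g (finfun f).
  rewrite genGid; apply: intro_class_fun => [x z Gx Gz|x /negPf]; last first.
    by rewrite /f => ->.
  rewrite /f groupJ ?Gx //.
  rewrite [RHS](reindex_inj (mulgI z)); apply: eq_big => y.
    by rewrite groupMl.
  by rewrite conjgM.
pose phi : 'CF(G) := Cfun 0 fP.
have -> : \sum_(y in G) 'chi_i (a * b ^ y)%g = phi b by rewrite cfunE /f Gb.
have phiE j : '[phi, 'chi_j] = #|G|%:R * ((i == j)%:R * ('chi_i a / 'chi_i 1%g)).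
  rewrite -generalized_orthogonality_relation cfdotE mulVKf ?neq0CG //.
  under eq_bigr => x Gx do rewrite cfunE /f Gx mulr_suml.
  rewrite exchange_big /=.
  under eq_bigr => y Gy.
    (* Replacing [x] by its conjugate under [y^-1] frees the summand of [y], since ['chi_j] is a
       class function. The sum over [y] then gives a factor [#|G|], and generalized orthogonality
       handles the sum over [x]. *)
    rewrite (reindex_inj (conjg_inj y^-1%g)).
    under eq_big => [x|x Gx].
      rewrite groupJr ?groupV //; over.
      rewrite conjgKV cfunJ ?groupV // -irr_inv.
      have -> : 'chi_i (a * x)%g = 'chi_i (x * a)%g.
        by rewrite -(cfunJ _ (x * a)%g (groupVr Ga)) conjgE invgK mulgK.
      over.
    over.
    by rewrite sumr_const -[X in _ * X = _]mulr_natl mulKf ?neq0CG.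
rewrite [phi]cfun_sum_cfdot sum_cfunE (bigD1 i) //= big1 ?addr0.
  by rewrite cfunE phiE eqxx mul1r -!mulrA [_^-1 * _]mulrC.
by move=> j /negPf ij; rewrite cfunE phiE eq_sym ij mul0r mulr0 mul0r.
Qed.

(** Taking [a = x^-1] and [b = x] in [irr_sum_mulJ] leaves the sum of the squared moduli of
    ['chi_i x], which is [#|G|] because ['chi_i] has norm 1. *)
Lemma irr_sum_commutator (i : Iirr G) :
  \sum_(x in G) \sum_(y in G) 'chi_i (x^-1 * y^-1 * x * y)%g
    = #|G|%:R ^+ 2 / 'chi_i 1%g.
Proof.
under eq_bigr => x Gx.
  under eq_bigr => y _ do rewrite -!mulgA -conjgE.
  rewrite irr_sum_mulJ ?groupV // irr_inv [_^* * _]mulrC mulrA.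
  over.
rewrite -mulr_suml -mulr_sumr; congr (_ / _).
have -> : \sum_(x in G) 'chi_i x * ('chi_i x)^* = #|G|%:R * '['chi_i].
  by rewrite cfdotE mulVKf ?neq0CG.
by rewrite cfnorm_irr mulr1 expr2.
Qed.

Lemma sum_commutator_fiber (F : gT -> algC) :
  \sum_(g in G) #|commutator_fiber G g|%:R * F g
    = \sum_(x in G) \sum_(y in G) F (x^-1 * y^-1 * x * y)%g.
Proof.
rewrite pair_big /=.
rewrite (partition_big (fun p => p.1^-1 * p.2^-1 * p.1 * p.2)%g [in G]) /=; last first.
  by move=> [x y] /andP[/= Gx Gy]; rewrite !groupM ?groupV.
apply: eq_bigr => g Gg; rewrite mulr_natl -sumr_const.
apply: eq_big => [p|p]; first by rewrite !inE.
by rewrite inE => /andP[_ /eqP ->].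
Qed.

Lemma card_commutator_fiberJ g z : z \in G ->
  #|commutator_fiber G (g ^ z)| = #|commutator_fiber G g|.
Proof.
(* Conjugating both entries of a pair by [z] conjugates their commutator by [z]. *)
move=> Gz; pose h (p : gT * gT) := (p.1 ^ z, p.2 ^ z)%g.
have h_inj : injective h by move=> [x y] [x' y'] [/conjg_inj -> /conjg_inj ->].
rewrite -(card_preimset _ h_inj); apply: eq_card => -[x y].
by rewrite !inE /= !groupJr // -!conjVg -!conjMg (inj_eq (conjg_inj z)).
Qed.

Lemma commutator_fiber_out g : g \notin G -> commutator_fiber G g = set0.
Proof.
move=> notGg; apply/setP => -[x y]; rewrite !inE /=.
apply/negP => /andP[/andP[Gx Gy] /eqP g_eq].
by case/negP: notGg; rewrite -g_eq !groupM ?groupV.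
Qed.

Lemma commutator_count_is_class_fun :
  is_class_fun <<G>>%g [ffun g => #|commutator_fiber G g|%:R].
Proof.
rewrite genGid; apply: intro_class_fun => [g z Gg Gz|g notGg].
  by rewrite card_commutator_fiberJ.
by rewrite commutator_fiber_out ?cards0.
Qed.

Definition commutator_count : 'CF(G) := Cfun 0 commutator_count_is_class_fun.

Lemma cfdot_commutator_count (i : Iirr G) :
  '[commutator_count, 'chi_i] = #|G|%:R / 'chi_i 1%g.
Proof.
rewrite cfdotE; under eq_bigr => g _ do rewrite cfunE.
rewrite (sum_commutator_fiber (fun g => ('chi_i g)^*)).
(* Conjugation moves out of both sums and then disappears, the degree being a natural number. *)
under eq_bigr => x _ do rewrite -rmorph_sum.
rewrite -rmorph_sum irr_sum_commutator rmorphM fmorphV rmorphXn rmorph_nat.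
by rewrite /= (conj_natr (Cnat_irr1 i)) expr2 -mulrA mulKf ?neq0CG.
Qed.

(** Parseval in the basis of irreducible characters: subtracting the constant [#|G|] cancels exactly
    the trivial coefficient, whence the [- 1]. *)
Lemma cfnorm_commutator_count_sub :
  '[commutator_count - #|G|%:R%:A]
    = #|G|%:R ^+ 2 * (\sum_(i : Iirr G) 'chi_i 1%g ^- 2 - 1).
Proof.
have coef i : '[commutator_count - #|G|%:R%:A, 'chi_i]
    = if i == 0 then 0 else #|G|%:R / 'chi_i 1%g.
  rewrite cfdotBl cfdot_commutator_count cfdotZl -irr0 cfdot_irr eq_sym.
  case: eqVneq => [->|_]; last by rewrite mulr0 subr0.
  by rewrite irr0 cfun11 divr1 mulr1 subrr.
rewrite cfdot_sum_irr (bigD1 0) //= coef eqxx mul0r add0r.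
rewrite [X in _ * (X - _)](bigD1 0) //= irr0 cfun11 expr1n invr1 [1 + _]addrC addrK.
rewrite mulr_sumr; apply: eq_bigr => i /negPf i0.
rewrite coef i0 fmorph_div rmorph_nat /= (conj_natr (Cnat_irr1 i)).
by rewrite -expr2 expr_div_n.
Qed.

Lemma irr1_irr_degree (i : Iirr G) : 'chi_i 1%g = (Defs.irr_degree i)%:R.
Proof. by rewrite truncnK ?Cnat_irr1. Qed.

(* Both sides are rational, so the identity proved in [algC] transfers to any
   field of characteristic zero. *)
Lemma commutator_count_variance (F : numFieldType) :
  \sum_(g in G) (#|commutator_fiber G g|%:R - #|G|%:R) ^+ 2
    = #|G|%:R ^+ 3 * (\sum_(i : Iirr G) (Defs.irr_degree i)%:R ^- 2 - 1) :> F.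
Proof.
suff rat_id : \sum_(g in G) (#|commutator_fiber G g|%:R - #|G|%:R) ^+ 2
    = #|G|%:R ^+ 3 * (\sum_(i : Iirr G) (Defs.irr_degree i)%:R ^- 2 - 1) :> rat.
  move/(congr1 (ratr : rat -> F)): rat_id.
  rewrite rmorphM rmorphB rmorph1 !rmorph_sum rmorphXn rmorph_nat /=.
  under eq_bigr => g _ do rewrite rmorphXn rmorphB !rmorph_nat.
  by under [in RHS]eq_bigr => i _ do rewrite fmorphV rmorphXn rmorph_nat.
apply: (fmorph_inj (ratr : {rmorphism rat -> algC})).
rewrite rmorphM rmorphB rmorph1 !rmorph_sum rmorphXn rmorph_nat /=.
under [in RHS]eq_bigr => i _ do
  rewrite fmorphV rmorphXn rmorph_nat -irr1_irr_degree.
have := cfnorm_commutator_count_sub; rewrite cfdotE.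
(* The factor [#|G|^-1] in the inner product turns the square of [#|G|] into a cube. *)
move/(canRL (mulVKf (neq0CG G))); rewrite mulrA -exprS => <-.
apply: eq_bigr => g Gg.
by rewrite !cfunE cfun1E Gg mulr1 rmorphXn !rmorphB /= !rmorph_nat.
Qed.

End CommutatorCount.

Lemma witten_zeta2 (R : realType) (gT : finGroupType) (G : {group gT}) :
  witten_zeta G (2 : R) = \sum_(i : Iirr G) (Defs.irr_degree i)%:R ^- 2.
Proof. by apply: eq_bigr => i _; rewrite powR_invn. Qed.

Theorem proposition1p1 (R : realType) (gT : finGroupType) (G : {group gT}) :
  l1_norm G (fun g => commutator_distr R G g - uniform_distr R G g)
    <= Num.sqrt (witten_zeta G (2 : R) - 1).
Proof.
have G_neq0 : #|G|%:R != 0 :> R by rewrite pnatr_eq0 -lt0n.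
rewrite -[leLHS]ger0_norm ?sumr_ge0 // -sqrtr_sqr; apply: ler_wsqrtr.
apply: le_trans (ler_sqr_sum_card _ _) _.
(* Only Cauchy-Schwarz loses anything; what remains is an equality, the powers 1, -4 and 3 of [#|G|]
   cancelling. *)
rewrite witten_zeta2 le_eqVlt; apply/orP; left; apply/eqP.
transitivity (#|G|%:R * (#|G|%:R ^- 4 *
    \sum_(g in G) (#|commutator_fiber G g|%:R - #|G|%:R) ^+ 2) : R).
  congr (_ * _); rewrite mulr_sumr; apply: eq_bigr => g _.
  rewrite real_normK ?num_real // /commutator_distr /uniform_distr.
  by field.
by rewrite commutator_count_variance; field.
Qed.
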